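(* Let $n$ be a positive integer and let $t$ be an integer. Suppose that $t \geq \max(100n^2, n^4)$ or $t \leq \min(-100n^2, -2n^4)$, and that $t^2+3n^2t+9n^4$ is squarefree. Then the point $(0,n^3)$ is not divisible on the elliptic curve over $\mathbb{Q}$ $$\mathcal{E}_n(t)\colon\ y^2=x^3+tx^2-n^2(t+3n^2)x+n^6,$$ i.e. there do not exist an integer $k\geq 2$ and a point $P\in \mathcal{E}_n(t)(\mathbb{Q})$ such that $kP=(0,n^3)$.
   Context: A point $Q$ of the group of rational points of an elliptic curve over $\mathbb{Q}$ is called divisible if $Q=kP$ for some integer $k\ge 2$ and some rational point $P$ on the curve. *)

(* Defs.v *)
From mathcomp Require Import all_boot all_order all_algebra.
From mathcomp Require Import ring lra.

Set Implicit Arguments.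
Unset Strict Implicit.
Unset Printing Implicit Defensive.

Import Order.TTheory GRing.Theory Num.Theory.
Local Open Scope ring_scope.

(* 0 is not squarefree, since every d * d divides it. *)
Definition squarefreez (m : int) : Prop :=
  forall d : int, (d * d %| m)%Z -> d \is a GRing.unit.

Section EllipticCurve.

Variable F : fieldType.

(* The discriminant of the Weierstrass equation y^2 = x^3 + a x^2 + b x + c:
   16 times the discriminant of the cubic. *)
Definition weierstrass_disc (a b c : F) : F :=
  16%:R * (a ^+ 2 * b ^+ 2 - 4%:R * b ^+ 3 - 4%:R * a ^+ 3 * c
           - 27%:R * c ^+ 2 + 18%:R * a * b * c).

(* Elliptic curves y^2 = x^3 + ec_a x^2 + ec_b x + ec_c; the smoothness
   condition excludes characteristic 2, where the discriminant vanishes. *)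
Record ellcurve := EllCurve {
  ec_a : F;
  ec_b : F;
  ec_c : F;
  ec_smooth : weierstrass_disc ec_a ec_b ec_c != 0
}.

Variable E : ellcurve.

(* None stands for the point at infinity. *)
Definition on_curve (P : option (F * F)) : bool :=
  if P is Some (x, y)
  then y ^+ 2 == x ^+ 3 + ec_a E * x ^+ 2 + ec_b E * x + ec_c E
  else true.

Definition ec_point := {P : option (F * F) | on_curve P}.

(* Slope of the chord, or of the tangent when the abscissae coincide (the
   points being then equal, as ec_add_raw excludes opposite points). *)
Definition ec_slope (x1 y1 x2 y2 : F) : F :=
  if x1 == x2
  then (3%:R * x1 ^+ 2 + 2%:R * ec_a E * x1 + ec_b E) / (2%:R * y1)
  else (y2 - y1) / (x2 - x1).

Definition ec_add_raw (P Q : option (F * F)) : option (F * F) :=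
  match P, Q with
  | None, _ => Q
  | _, None => P
  | Some (x1, y1), Some (x2, y2) =>
      if (x1 == x2) && (y1 == - y2) then None
      else
        let l := ec_slope x1 y1 x2 y2 in
        let x3 := l ^+ 2 - ec_a E - x1 - x2 in
        Some (x3, l * (x1 - x3) - y1)
  end.

Lemma ec_add_subproof (P Q : ec_point) :
  on_curve (ec_add_raw (val P) (val Q)).
Proof.
case: P Q => [[[x1 y1]|] HP] [[[x2 y2]|] HQ] //=.
move: HP HQ; rewrite /ec_add_raw /on_curve /= => /eqP HP /eqP HQ.
case: ifP => //= Hopp; rewrite /ec_slope.
have Ec : ec_c E = y1 ^+ 2 - x1 ^+ 3 - ec_a E * x1 ^+ 2 - ec_b E * x1.
  by rewrite HP; ring.
case: eqVneq Hopp => [Ex /= Hy|Dx _].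
  subst x2.
  have Ey : y1 = y2.
    have /eqP : (y1 - y2) * (y1 + y2) = 0.
      by rewrite -subr_sqr HP HQ subrr.
    by rewrite mulf_eq0 subr_eq0 addr_eq0 Hy orbF => /eqP.
  subst y2.
  have nz : 2%:R * y1 != 0.
    by apply: contraFN Hy; rewrite -addr_eq0 mulr_natl mulr2n.
  set l := _ / _.
  have Eb : ec_b E = l * (2%:R * y1) - 3%:R * x1 ^+ 2 - 2%:R * ec_a E * x1.
    by rewrite /l divfK //; ring.
  by rewrite Ec Eb; apply/eqP; ring.
have nz : x2 - x1 != 0 by rewrite subr_eq0 eq_sym.
set l := _ / _.
have Ey : y2 = y1 + l * (x2 - x1) by rewrite /l divfK //; ring.
have Eb : ec_b E = l * (y1 + y2) - (x1 ^+ 2 + x1 * x2 + x2 ^+ 2)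
                   - ec_a E * (x1 + x2).
  apply: (mulIf nz).
  have -> : (l * (y1 + y2) - (x1 ^+ 2 + x1 * x2 + x2 ^+ 2)
             - ec_a E * (x1 + x2)) * (x2 - x1)
     = y2 ^+ 2 - y1 ^+ 2 - (x2 ^+ 3 - x1 ^+ 3) - ec_a E * (x2 ^+ 2 - x1 ^+ 2).
    by rewrite Ey; ring.
  by rewrite HP HQ; ring.
by rewrite Ec Eb Ey; apply/eqP; ring.
Qed.

Definition ec_zero : ec_point := exist on_curve None isT.

Definition ec_add (P Q : ec_point) : ec_point :=
  exist on_curve (ec_add_raw (val P) (val Q)) (ec_add_subproof P Q).

Definition ec_mul (k : nat) (P : ec_point) : ec_point :=
  iter k (ec_add P) ec_zero.

Definition ec_divisible (Q : ec_point) : Prop :=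
  exists (k : nat) (P : ec_point), (2 <= k)%N /\ ec_mul k P = Q.

End EllipticCurve.

Section Family.

Variables (n t : int).

Definition En_a : rat := t%:Q.
Definition En_b : rat := - (n%:Q ^+ 2 * (t%:Q + 3%:R * n%:Q ^+ 2)).
Definition En_c : rat := n%:Q ^+ 6.

Hypothesis n_gt0 : 0 < n.

Lemma En_smooth : weierstrass_disc En_a En_b En_c != 0.
Proof.
have n0 : n%:Q != 0 by rewrite intr_eq0 gt_eqF.
have -> : weierstrass_disc En_a En_b En_c = 16%:R * n%:Q ^+ 4 *
   (t%:Q ^+ 2 + 3%:R * n%:Q ^+ 2 * t%:Q + 9%:R * n%:Q ^+ 4) ^+ 2.
  by rewrite /weierstrass_disc /En_a /En_b /En_c; ring.
apply: mulf_neq0; first by rewrite mulf_neq0 ?expf_neq0.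
apply: expf_neq0.
have n4 : 0 < n%:Q ^+ 4 by rewrite lt_def expf_neq0 //= exprn_even_ge0.
have sq : 0 <= (2%:R * t%:Q + 3%:R * n%:Q ^+ 2) ^+ 2 by exact: sqr_ge0.
by rewrite gt_eqF //; nra.
Qed.

Definition En : ellcurve rat := EllCurve En_smooth.

Lemma En_base_subproof : on_curve En (Some (0, n%:Q ^+ 3)).
Proof. by rewrite /on_curve /= /En_c; apply/eqP; ring. Qed.

Definition En_base : ec_point En :=
  exist (on_curve En) (Some (0, n%:Q ^+ 3)) En_base_subproof.

End Family.

(* Main.v *)
Require Import Defs.
From mathcomp Require Import all_boot all_order all_algebra.
From mathcomp Require Import ring lra zify.
From mathcomp Require Import qfpoly.

Set Implicit Arguments.
Unset Strict Implicit.
Unset Printing Implicit Defensive.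

Import Order.TTheory GRing.Theory Num.Theory.
Local Open Scope ring_scope.

(** Write f = x^3 + t x^2 - n^2 (t + 3 n^2) x + n^6, D = t^2 + 3 n^2 t + 9 n^4
    and Q = (0, n^3), and suppose k P = Q.  Since D is squarefree, f is
    irreducible; let theta be its class in the field L = Q[X]/f.  The chord
    construction shows that x(k P) - theta = (x(P) - theta)^k modulo squares of
    L.  Multiples of a point which is not p-integral are never p-integral, so
    a = x(P) is an integer.

    If k is odd, - theta (a - theta) is a square in L.  Comparing coefficients
    in X^2 - a X = g(X)^2 modulo f, either a = 0, or there is a rational s with
    H(s) a nonzero square and a = 4 n^2 G(s) / H(s), where
      H(s) = (s^2 - t)^2 + 4 n^2 (t + 3 n^2 - 2 n s),
      G(s) = n s^3 - (t + 3 n^2) s^2 + n t s + n^4.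
    Clearing denominators, s = u/q and a Z^2 = 4 n^2 q G(u, q) with
    Z^2 = H(u, q).  As D is squarefree, Z is prime to q G(u, q), so Z^2 divides
    4 n^2; but H(u, q) > 4 n^2 as soon as |t| >= 100 n^2.

    If k is even, the same computation with - theta a square yields H(s) = 0,
    which is impossible.  This also shows that the odd multiples of Q are not
    0; as there is no point of order 2, Q is not a torsion point, which
    excludes a = 0, that is P = Q or P = - Q. *)

(** * Addition on a Weierstrass curve *)

Section GroupLaw.

Variables (F : fieldType) (E : ellcurve F).
Implicit Types P X : option (F * F).

Lemma ec_two_neq0 : 2%:R != 0 :> F.
Proof.
apply: contraNneq (ec_smooth E) => two0; rewrite /weierstrass_disc.
by rewrite (natrX _ 2 4) two0 expr0n !mul0r.
Qed.

(* The line y = l x + m through two points meets the curve in a third one, of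
   abscissa x3: the conclusion is the comparison of the coefficients in
   f(X) - (l X + m)^2 = (X - x1) (X - x2) (X - x3). *)
Lemma ec_chord x1 y1 x2 y2 (l := ec_slope E x1 y1 x2 y2) (m := y1 - l * x1)
    (x3 := l ^+ 2 - ec_a E - x1 - x2) :
    on_curve E (Some (x1, y1)) -> on_curve E (Some (x2, y2)) ->
    ~~ ((x1 == x2) && (y1 == - y2)) ->
  [/\ y2 = l * x2 + m,
      ec_b E = x1 * x2 + x1 * x3 + x2 * x3 + 2%:R * l * m
    & ec_c E = m ^+ 2 - x1 * x2 * x3].
Proof.
rewrite /on_curve /x3 /m /l /ec_slope => /eqP HP /eqP HQ Hopp.
have Ec : ec_c E = y1 ^+ 2 - x1 ^+ 3 - ec_a E * x1 ^+ 2 - ec_b E * x1.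
  by rewrite HP; ring.
case: eqVneq Hopp => [Ex /= Hy|Dx _].
  subst x2.
  have Ey : y1 = y2.
    have /eqP : (y1 - y2) * (y1 + y2) = 0 by rewrite -subr_sqr HP HQ subrr.
    by rewrite mulf_eq0 subr_eq0 addr_eq0 (negPf Hy) orbF => /eqP.
  subst y2.
  have nz : 2%:R * y1 != 0.
    by apply: contraNN Hy; rewrite -addr_eq0 mulr_natl mulr2n.
  set k := _ / _.
  have Eb : ec_b E = k * (2%:R * y1) - 3%:R * x1 ^+ 2 - 2%:R * ec_a E * x1.
    by rewrite /k divfK //; ring.
  by split; rewrite ?Ec ?Eb; ring.
have nz : x2 - x1 != 0 by rewrite subr_eq0 eq_sym.
set k := _ / _.
have Ey : y2 = y1 + k * (x2 - x1) by rewrite /k divfK //; ring.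
have Eb : ec_b E = k * (y1 + y2) - (x1 ^+ 2 + x1 * x2 + x2 ^+ 2)
                   - ec_a E * (x1 + x2).
  apply: (mulIf nz).
  have -> : (k * (y1 + y2) - (x1 ^+ 2 + x1 * x2 + x2 ^+ 2)
             - ec_a E * (x1 + x2)) * (x2 - x1)
     = y2 ^+ 2 - y1 ^+ 2 - (x2 ^+ 3 - x1 ^+ 3) - ec_a E * (x2 ^+ 2 - x1 ^+ 2).
    by rewrite Ey; ring.
  by rewrite HP HQ; ring.
by split; rewrite ?Ec ?Eb ?Ey; ring.
Qed.

Definition ec_opp_raw P : option (F * F) :=
  if P is Some (x, y) then Some (x, - y) else None.

Lemma ec_add_on_curve P X :
  on_curve E P -> on_curve E X -> on_curve E (ec_add_raw E P X).
Proof.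
by move=> HP HX; exact: (ec_add_subproof (exist _ P HP) (exist _ X HX)).
Qed.

Lemma ec_oppK : involutive ec_opp_raw.
Proof. by case=> [[x y]|] //=; rewrite opprK. Qed.

Lemma ec_addN P : ec_add_raw E P (ec_opp_raw P) = None.
Proof. by case: P => [[x y]|] //=; rewrite opprK !eqxx. Qed.

Lemma ec_oppD P X : ec_opp_raw (ec_add_raw E P X) =
  ec_add_raw E (ec_opp_raw P) (ec_opp_raw X).
Proof.
case: P X => [[x1 y1]|] [[x2 y2]|] //=.
rewrite opprK eqr_oppLR; case: ifP => //= _.
have -> : ec_slope E x1 (- y1) x2 (- y2) = - ec_slope E x1 y1 x2 y2.
  rewrite /ec_slope; case: ifP => _; first by rewrite mulrN invrN mulrN.
  by rewrite -opprD mulNr.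
by rewrite sqrrN; congr (Some (_, _)); ring.
Qed.

(** The chord from [- P] to [P + X] is the mirror image of the line through [P] and [X], so its
    slope is [- l]. *)
Lemma ec_addNK_abscissa x1 y1 X x3 y3 :
    on_curve E (Some (x1, y1)) -> on_curve E X ->
    ec_add_raw E (Some (x1, y1)) X = Some (x3, y3) -> x1 != x3 ->
  ec_add_raw E (Some (x1, - y1)) (Some (x3, y3)) = X.
Proof.
case: X => [[x2 y2]|] HP HX /=; last by case=> -> _; rewrite eqxx.
case: ifPn => // Hopp [E3 Ey] D13.
have [Ey2 _ _] := ec_chord HP HX Hopp; set l := ec_slope _ _ _ _ _ in E3 Ey Ey2.
have nz : x3 - x1 != 0 by rewrite subr_eq0 eq_sym.
rewrite (negPf D13) /= /ec_slope (negPf D13).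
have -> : (y3 - - y1) / (x3 - x1) = - l.
  by apply: (mulIf nz); rewrite divfK // -Ey E3; ring.
by congr (Some (_, _)); rewrite ?Ey2 -E3; ring.
Qed.

(** Cancellation takes the place of associativity. The main case left by [ec_addNK_abscissa] is
    [P + X = - P], where the tangent at [- P] has slope [- l]. *)
Lemma ec_addKN P X : (forall x, ~~ on_curve E (Some (x, 0))) ->
    on_curve E P -> on_curve E X ->
  ec_add_raw E (ec_opp_raw P) (ec_add_raw E P X) = X.
Proof.
move=> no2; case: P => [[x1 y1]|] // HP HX.
case DY: (ec_add_raw E _ X) => [[x3 y3]|]; last first.
  case: X HX DY => [[x2 y2]|] //= HX.
  by case: ifP => // /andP[/eqP-> /eqP->] _; rewrite opprK.
have [E13|D13] := eqVneq x1 x3; last exact: ec_addNK_abscissa DY D13.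
case: X HX DY => [[x2 y2]|] HX /=; last first.
  by case=> -> ->; rewrite eqxx eqxx.
case: ifPn => // Hopp [E3 Ey].
have [Ey2 Eb Ec] := ec_chord HP HX Hopp.
set l := ec_slope _ _ _ _ _ in E3 Ey Ey2 Eb Ec.
have y1nz : y1 != 0 by apply: contraNneq (no2 x1) => <-.
have y3E : y3 = - y1 by rewrite -Ey E3 E13; ring.
have y1y1 : 2%:R * - y1 != 0 by rewrite mulf_neq0 ?ec_two_neq0 ?oppr_eq0.
rewrite -{}E13 in E3 *; rewrite eqxx y3E eqr_oppLR opprK /=.
case: eqP => [H|_].
  by case/eqP: y1y1; rewrite mulr_natl mulr2n {1}H addNr ?subrr.
rewrite /ec_slope eqxx.
have -> : (3%:R * x1 ^+ 2 + 2%:R * ec_a E * x1 + ec_b E) / (2%:R * - y1) = - l.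
  apply: (mulIf y1y1); rewrite divfK // Eb E3.
  have -> : ec_a E = l ^+ 2 - x1 - x2 - (l ^+ 2 - ec_a E - x1 - x2) by ring.
  rewrite E3.
  by ring.
by congr (Some (_, _)); rewrite ?Ey2 -{2}E3; ring.
Qed.

End GroupLaw.

(** * The 2-descent map *)

Section DescentMap.

Variables (F L : fieldType) (E : ellcurve F).
Variables (phi : {rmorphism F -> L}) (theta : L).
Hypothesis theta_root :
  theta ^+ 3 + phi (ec_a E) * theta ^+ 2 + phi (ec_b E) * theta + phi (ec_c E)
  = 0.
Hypothesis theta_nbase : forall x, phi x != theta.

(** The [x - theta] map of 2-descent, with values kept in [L]; equality modulo squares is stated
    with an explicit factor [g ^+ 2]. *)
Definition descent (P : option (F * F)) : L :=
  if P is Some (x, _) then phi x - theta else 1.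

Lemma descent_neq0 P : descent P != 0.
Proof. by case: P => [[x y]|] /=; rewrite ?oner_neq0 // subr_eq0. Qed.

(** Evaluating the identity of [ec_chord] at [theta] shows that the product of the three values
    [x_i - theta] is the square of [l theta + m]. *)
Lemma descentD P X : on_curve E P -> on_curve E X ->
  exists g, descent (ec_add_raw E P X) = descent P * descent X * g ^+ 2.
Proof.
case: P X => [[x1 y1]|] [[x2 y2]|] HP HX /=; try by exists 1; ring.
have d1 := descent_neq0 (Some (x1, y1)); have d2 := descent_neq0 (Some (x2, y2)).
rewrite /= in d1 d2; case: ifPn => [/andP[/eqP<- _]|Hopp].
  by exists (phi x1 - theta)^-1; rewrite exprVn -expr2 divff // expf_neq0.
have [_ Eb Ec] := ec_chord HP HX Hopp.
set l := ec_slope _ _ _ _ _ in Eb Ec *; set m := y1 - _ in Eb Ec.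
set x3 := _ - x2 in Eb Ec *.
have Ea : ec_a E = l ^+ 2 - x1 - x2 - x3 by rewrite /x3; ring.
have E123 : (phi x1 - theta) * (phi x2 - theta) * (phi x3 - theta) =
    (phi l * theta + phi m) ^+ 2.
  have /eqP := theta_root; rewrite Ea Eb Ec.
  rewrite !(rmorphB, rmorphD, rmorphM, rmorphXn, rmorph_nat) => /eqP H0.
  by rewrite -[RHS]subr0 -H0; ring.
exists ((phi l * theta + phi m) / ((phi x1 - theta) * (phi x2 - theta))).
by rewrite exprMn -E123 /=; field; rewrite d1 d2.
Qed.

Lemma descent_mul k (P : ec_point E) :
  exists g, descent (val (ec_mul k P)) = descent (val P) ^+ odd k * g ^+ 2.
Proof.
elim: k => [|k [g IH]]; first by exists 1; rewrite expr1n mulr1.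
have [h Eh] := descentD (valP P) (valP (ec_mul k P)).
(* For odd [k] the new factor absorbs the square of [descent (val P)]. *)
exists (h * g * (if odd k then descent (val P) else 1)).
rewrite [LHS]Eh IH /=; case: (odd k) => /=; ring.
Qed.

End DescentMap.

(** The quotient field is used only through a surjective morphism and its kernel, so that results in
    it translate into divisibility by [f]. *)
Lemma residue_field (F : fieldType) (f : {poly F}) :
    irreducible_poly f -> f \is monic ->
  exists (L : fieldType) (phi : {rmorphism {poly F} -> L}),
    (forall u, exists p, phi p = u) /\ (forall p, phi p = 0 <-> f %| p).
Proof.
move=> f_irr f_monic; pose hI : monic_irreducible_poly f := (f_irr, f_monic).
exists {poly %/ f with hI}, (in_qpoly f); split.
  move=> u; exists (val u); apply: val_inj; apply: in_qpoly_small.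
  exact: size_mk_monic.
have modE p : val (in_qpoly f p) = p %% f.
  by rewrite /= (mk_monicE hI) Pdiv.IdomainMonic.modpE.
move=> p; rewrite /dvdp -modE; split=> [->|/eqP p0]; first exact/eqP.
exact: val_inj.
Qed.

(** * Integrality at a prime *)

Section LocalIntegrality.

Variables (p : nat) (p_prime : prime p).

Lemma Euclid_dvdzM (u v : int) : (p %| u * v)%Z = (p %| u)%Z || (p %| v)%Z.
Proof. by rewrite !dvdzE abszM Euclid_dvdM. Qed.

Lemma Euclid_dvdzX (u : int) m : (p %| u ^+ m.+1)%Z = (p %| u)%Z.
Proof. by rewrite !dvdzE abszX Euclid_dvdX ?andbT. Qed.

Definition pintegral (x : rat) : bool := ~~ (p %| denq x)%Z.

Lemma pintegral_frac (u v : int) : ~~ (p %| v)%Z -> pintegral (u%:Q / v%:Q).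
Proof.
move=> pv; apply: contra (pv) => /dvdz_trans; apply.
have v0 : v%:Q != 0 by rewrite intr_eq0; apply: contraNneq (pv) => ->.
rewrite -(@Gauss_dvdzr _ (numq (u%:Q / v%:Q))); last first.
  by rewrite coprimezE coprime_sym coprime_num_den.
set x := u%:Q / v%:Q; apply/dvdzP; exists u.
apply: (@intr_inj rat); rewrite !intrM numqE /x; field.
by rewrite v0.
Qed.

Lemma pintegralP x :
  pintegral x -> exists u v : int, ~~ (p %| v)%Z /\ x = u%:Q / v%:Q.
Proof. by exists (numq x), (denq x); rewrite divq_num_den. Qed.

Lemma pdvdN_intr_neq0 (v : int) : ~~ (p %| v)%Z -> v%:Q != 0.
Proof. by rewrite intr_eq0; apply: contraNneq => ->. Qed.

Lemma pintegral_int (u : int) : pintegral u%:Q.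
Proof.
rewrite -[u%:Q]divr1; apply: (@pintegral_frac u 1).
by rewrite dvdz1 eqn_leq negb_and -!ltnNge prime_gt1.
Qed.

Lemma pintegralD x y : pintegral x -> pintegral y -> pintegral (x + y).
Proof.
move=> /pintegralP[u [v [pv ->]]] /pintegralP[u' [v' [pv' ->]]].
rewrite addf_div ?pdvdN_intr_neq0 // -!intrM -intrD.
by apply: pintegral_frac; rewrite Euclid_dvdzM negb_or pv.
Qed.

Lemma pintegralM x y : pintegral x -> pintegral y -> pintegral (x * y).
Proof.
move=> /pintegralP[u [v [pv ->]]] /pintegralP[u' [v' [pv' ->]]].
rewrite mulf_div -!intrM.
by apply: pintegral_frac; rewrite Euclid_dvdzM negb_or pv.
Qed.

Lemma pintegralN x : pintegral x -> pintegral (- x).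
Proof.
by move=> ?; rewrite -mulN1r; exact: (pintegralM (pintegral_int (-1))).
Qed.

Lemma pintegralX x m : pintegral x -> pintegral (x ^+ m).
Proof.
move=> px; elim: m => [|m IH]; first exact: (pintegral_int 1).
by rewrite exprS pintegralM.
Qed.

(** The local ring at [p] is integrally closed. *)
Lemma pintegral_sqrt x : pintegral (x ^+ 2) -> pintegral x.
Proof.
move=> /pintegralP[u [v [pv E]]]; apply/negP => pden.
have E2 : numq x ^+ 2 * v = u * denq x ^+ 2.
  apply: (@intr_inj rat).
  rewrite [LHS]intrM [RHS]intrM !rmorphXn /= numqE exprMn E.
  by field; rewrite pdvdN_intr_neq0.
have : (p %| numq x ^+ 2 * v)%Z by rewrite E2 dvdz_mull // Euclid_dvdzX.
rewrite Euclid_dvdzM Euclid_dvdzX (negPf pv) orbF => pnum.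
have : (p %| gcdz (numq x) (denq x))%Z by rewrite dvdz_gcd pnum.
have /eqP -> : coprimez (numq x) (denq x) by rewrite coprimezE coprime_num_den.
(* The denominator of 0 is 1, so integrality of 0 says that [p] does not divide 1. *)
by apply/negP; exact: (pintegral_int 0).
Qed.

(** Here [x^-1] lies in the maximal ideal, so [1 - y * x^-1] is a unit. *)
Lemma pintegral_inv x : ~~ pintegral x ->
  pintegral x^-1 /\ forall y, pintegral y -> pintegral (1 - y * x^-1)^-1.
Proof.
rewrite negbK => pden.
have pnum : ~~ (p %| numq x)%Z.
  apply/negP => pnum.
  have : (p %| gcdz (numq x) (denq x))%Z by rewrite dvdz_gcd pnum.
  have /eqP -> : coprimez (numq x) (denq x) by rewrite coprimezE coprime_num_den.
  by apply/negP; exact: (pintegral_int 0).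
have Ex : x^-1 = (denq x)%:Q / (numq x)%:Q.
  by rewrite -{1}[x]divq_num_den invf_div.
split; first by rewrite Ex pintegral_frac.
move=> y /pintegralP[u [v [pv ->]]].
have pw : ~~ (p %| v * numq x - u * denq x)%Z.
  have -> : (p %| v * numq x - u * denq x)%Z = (p %| v * numq x)%Z.
    by apply: rpredBr; rewrite dvdz_mull.
  by rewrite Euclid_dvdzM negb_or pv.
have -> : (1 - u%:Q / v%:Q * x^-1)^-1 =
    (v * numq x)%:Q / (v * numq x - u * denq x)%:Q.
  have := pdvdN_intr_neq0 pw; rewrite rmorphB !rmorphM /= => w0.
  rewrite Ex; field; apply/and3P; split; first exact: w0.
    exact: (pdvdN_intr_neq0 pnum).
  exact: (pdvdN_intr_neq0 pv).
exact: pintegral_frac.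
Qed.

Variables (E : ellcurve rat).
Hypotheses (int_a : pintegral (ec_a E)) (int_b : pintegral (ec_b E))
  (int_c : pintegral (ec_c E)).

(** Infinity counts as non-integral: the non-integral points are those reducing to infinity modulo
    [p]. *)
Definition pintegral_point (P : option (rat * rat)) : bool :=
  if P is Some (x, _) then pintegral x else false.

(* The addition formula is rewritten in terms of 1/x1, which lies in the
   maximal ideal of the local ring at p, and of y1/x1^2, which lies in the
   local ring. *)
Lemma pintegral_third_point x1 y1 x3 y3 :
    on_curve E (Some (x1, y1)) -> on_curve E (Some (x3, y3)) ->
    ~~ pintegral x1 -> pintegral x3 ->
  pintegral (((y3 + y1) / (x3 - x1)) ^+ 2 - ec_a E - x1 - x3).
Proof.
move=> /eqP H1 /eqP H3 p1 p3.
have x1_0 : x1 != 0 by apply: contraNneq p1 => ->; exact: (pintegral_int 0).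
have D13 : x1 - x3 != 0 by rewrite subr_eq0; apply: contraNneq p1 => ->.
have [pe pu] := pintegral_inv p1; have {pu} pu := pu _ p3.
set e := x1^-1 in pe pu.
have py3 : pintegral y3.
  by apply: pintegral_sqrt; rewrite H3 !(pintegralD, pintegralM, pintegralX).
have peta : pintegral (y1 / x1 ^+ 2).
  apply: pintegral_sqrt.
  have -> : (y1 / x1 ^+ 2) ^+ 2 =
      e + ec_a E * e ^+ 2 + ec_b E * e ^+ 3 + ec_c E * e ^+ 4.
    by rewrite expr_div_n H1 /e; field.
  by rewrite !(pintegralD, pintegralM, pintegralX).
set eta := y1 / x1 ^+ 2 in peta.
have -> : ((y3 + y1) / (x3 - x1)) ^+ 2 - ec_a E - x1 - x3 =
   (2%:Z%:Q * eta * y3 + y3 ^+ 2 * e ^+ 2 + x3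
    + (ec_b E + x3 ^+ 2 + 2%:Z%:Q * ec_a E * x3) * e
    + (ec_c E - x3 ^+ 3 - ec_a E * x3 ^+ 2) * e ^+ 2) * (1 - x3 * e)^-1 ^+ 2.
  rewrite expr_div_n sqrrD H1 /eta /e; field.
  by rewrite x1_0 D13 -[x3 - x1]opprB oppr_eq0.
clearbody e eta; have p2 := pintegral_int 2; move: (2%:Z%:Q) p2 => two p2.
by rewrite !(pintegralD, pintegralN, pintegralM, pintegralX).
Qed.

(** [X] is the sum of [- P] and [P + X], whose abscissae differ because only one is integral;
    [pintegral_third_point] then applies. *)
Lemma pintegral_addr P X :
    on_curve E P -> on_curve E X -> P != None -> ~~ pintegral_point P ->
  pintegral_point (ec_add_raw E P X) -> pintegral_point X.
Proof.
case: P => [[x1 y1]|] // HP HX _ p1.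
have := ec_add_on_curve HP HX.
case DY: (ec_add_raw E _ X) => [[x3 y3]|] //= HY p3.
have D13 : x1 != x3 by apply: contraNneq p1 => ->.
rewrite -(ec_addNK_abscissa HP HX DY D13) /= (negPf D13) /= /ec_slope.
rewrite (negPf D13) opprK; exact: pintegral_third_point.
Qed.

Lemma pintegral_mul k (P : ec_point E) : val P != None ->
  pintegral_point (val (ec_mul k P)) -> pintegral_point (val P).
Proof.
move=> P0; apply: contraTT => pP; elim: k => // k; apply: contra.
exact: (pintegral_addr (valP P) (valP (ec_mul k P)) P0 pP).
Qed.

End LocalIntegrality.

Lemma pintegral_all x : (forall p, prime p -> pintegral p x) ->
  x = (numq x)%:Q.
Proof.
move=> px; suff d1 : denq x = 1 by rewrite numqE d1 mulr1.
have := px (pdiv `|denq x|); rewrite /pintegral dvdzE pdiv_dvd => pd.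
have [d_gt1|] := ltnP 1 `|denq x|; first by have := pd (pdiv_prime d_gt1).
rewrite -lez_nat absz_denq => d_le1; apply/eqP.
by rewrite eq_le d_le1 -gtz0_ge1 denq_gt0.
Qed.

(** * Integral points on the halving quartic *)

Lemma int_parity (x : int) : exists y, x = 2 * y \/ x = 2 * y + 1.
Proof. by exists (x %/ 2)%Z; lia. Qed.

Lemma exists_prime_dvd m : m != 1%N -> exists2 p, prime p & (p %| m)%N.
Proof.
case: m => [|[|m]] // _; first by exists 2%N.
by exists (pdiv m.+2); rewrite ?pdiv_prime ?pdiv_dvd.
Qed.

Section Arithmetic.

Variables n t : int.
Hypothesis n_gt0 : 0 < n.
Let D := t ^+ 2 + 3 * n ^+ 2 * t + 9 * n ^+ 4.
Hypothesis sqf : squarefreez D.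

Lemma squarefreez_prime p : prime p -> ~~ (p%:Z * p%:Z %| D)%Z.
Proof.
move=> pp; apply/negP => /sqf /orP[] /eqP; have := prime_gt1 pp; lia.
Qed.

(** If [p] divides [D] and [n], it divides [t], and [p^2] divides [D]. For odd [n], [D] is odd; if 3
    divides [D], it divides [t], and 9 divides [D]. *)
Lemma prime_dvd_disc p : prime p -> (p %| D)%Z ->
  [/\ ~~ (p %| n)%Z, ~~ (p %| 2)%Z & ~~ (p %| 3)%Z].
Proof.
move=> pp pD; have psq := squarefreez_prime pp.
have pnt : ~~ ((p %| n)%Z && (p %| t)%Z).
  apply: contra psq => /andP[/dvdzP[x En] /dvdzP[y Et]]; apply/dvdzP.
  exists (y ^+ 2 + 3 * x ^+ 2 * y * p + 9 * x ^+ 4 * p ^+ 2).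
  by rewrite /D En Et; ring.
have pn : ~~ (p %| n)%Z.
  apply: contra pnt => pn; rewrite pn -(Euclid_dvdzX pp _ 1).
  have -> : t ^+ 2 = D - n * (3 * n * t + 9 * n ^+ 3) by rewrite /D; ring.
  by rewrite rpredB // dvdz_mulr.
split=> //.
  apply/negP => p2; have Ep : p%:Z = 2.
    by move: p2; rewrite dvdzE /= dvdn_prime2 // => /eqP ->.
  have [x [En|En]] := int_parity n.
    by case/negP: pn; rewrite En Ep dvdz_mulr.
  have [y Ey] : exists y, t * (t + 1) = 2 * y.
    have [y [->|->]] := int_parity t.
      by exists (y * (2 * y + 1)); ring.
    by exists ((2 * y + 1) * (y + 1)); ring.
  (* The subtracted term is [D - 1], written as an even number for [n = 2 x + 1]. *)
  have E1 : D - 2 * (y + t * (1 + 6 * x * (x + 1)) + 4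
        + 36 * x * (x + 1) * (2 * x ^+ 2 + 2 * x + 1)) = 1.
    have -> : D = t * (t + 1) + (3 * n ^+ 2 - 1) * t + 9 * n ^+ 4.
      by rewrite /D; ring.
    by rewrite Ey En; ring.
  have : (p %| 1%R)%Z by rewrite -E1 rpredB // dvdz_mulr.
  by rewrite dvdz1; case: p pp {pD pn psq pnt p2 Ep} => [|[|p]].
apply/negP => p3; have Ep : p%:Z = 3.
  by move: p3; rewrite dvdzE /= dvdn_prime2 // => /eqP ->.
have /dvdzP[y Et] : (p %| t)%Z.
  rewrite -(Euclid_dvdzX pp _ 1).
  have -> : t ^+ 2 = D - 3 * (n ^+ 2 * t + 3 * n ^+ 4) by rewrite /D; ring.
  by rewrite rpredB // dvdz_mulr.
case/negP: psq; apply/dvdzP; exists (y ^+ 2 + n ^+ 2 * y + n ^+ 4).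
by rewrite /D Et Ep; ring.
Qed.

(* 27 f = (3 X + t)^3 - D (9 X + t - 3 n^2): modulo a prime divisor p of D, the
   cubic f has a triple root, and an integral root would force p^2 to divide D. *)
Lemma no_integral_root e :
  e ^+ 3 + t * e ^+ 2 - n ^+ 2 * (t + 3 * n ^+ 2) * e + n ^+ 6 != 0.
Proof.
apply/eqP => e_root; pose v := 3 * e + t; pose w := 2 * t + 3 * n ^+ 2.
(* Since [4 D = w^2 + 27 n^4], [D] has a prime divisor. *)
have D_gt1 : (1 < `|D|)%N.
  have D4 : 4 * D = w ^+ 2 + 27 * n ^+ 4 by rewrite /D /w; ring.
  have n1 : 1 <= n ^+ 4 by rewrite exprn_ege1 // -gtz0_ge1.
  have := sqr_ge0 w; clearbody D w.
  by move: (w ^+ 2) (n ^+ 4) D4 n1 => x y; clear; lia.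
have pp := pdiv_prime D_gt1; set p := pdiv _ in pp.
have pD : (p %| D)%Z by rewrite dvdzE pdiv_dvd.
have [pn _ p3] := prime_dvd_disc pp pD.
have Ev : v ^+ 3 = D * (3 * v - w).
  rewrite -[LHS]subr0 -[0](mulr0 27) -e_root /v /w /D; ring.
have pv : (p %| v)%Z by rewrite -(Euclid_dvdzX pp _ 2) Ev dvdz_mulr.
have pw : ~~ (p %| w)%Z.
  apply: contra p3 => pw; have : (p %| 3 ^+ 3 * n ^+ 4)%Z.
    have -> : 3 ^+ 3 * n ^+ 4 = 4 * D - w * w by rewrite /D /w; ring.
    by rewrite rpredB // ?dvdz_mull // dvdz_mulr.
  by rewrite Euclid_dvdzM // !Euclid_dvdzX // (negPf pn) orbF.
case/negP: (squarefreez_prime pp).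
rewrite -(@Gauss_dvdzl _ _ w); last first.
  by rewrite coprimezMl andbb coprimezE /= prime_coprime -?dvdzE.
(* As [v^3 = D (3 v - w)] and [p] divides both [D] and [v], [D w] is a multiple of [p^2]. *)
have -> : D * w = 3 * (D * v) - v * (v * v).
  have -> : v * (v * v) = v ^+ 3 by ring.
  by rewrite Ev; ring.
by apply: rpredB; apply: dvdz_mull; exact: dvdz_mul.
Qed.

Lemma no_rational_root (x : rat) :
  x ^+ 3 + t%:Q * x ^+ 2 - n%:Q ^+ 2 * (t%:Q + 3%:R * n%:Q ^+ 2) * x + n%:Q ^+ 6
    != 0.
Proof.
apply/eqP => x_root.
have coprime_denq : coprimez (denq x) (numq x ^+ 3).
  by rewrite coprimezXr // coprimez_sym coprimezE coprime_num_den.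
have d1 : denq x = 1.
  have : (denq x %| numq x ^+ 3 * 1%R)%Z.
    apply/dvdzP; exists (- (t * numq x ^+ 2
      - n ^+ 2 * (t + 3 * n ^+ 2) * numq x * denq x + n ^+ 6 * denq x ^+ 2)).
    apply: (@intr_inj rat); apply: subr0_eq; rewrite -(mul0r ((denq x)%:Q ^+ 3)).
    rewrite -x_root mulr1 [in RHS]mulrDl.
    move: (numqE x); set d := denq x; set m := numq x => Em.
    by rewrite !(rmorphXn, rmorphM, rmorphD, rmorphN, rmorphB) /= Em; ring.
  rewrite Gauss_dvdzr // dvdz1 => /eqP d1.
  by rewrite -absz_denq d1.
have := no_integral_root (numq x); rewrite -(intr_eq0 rat).
rewrite !(rmorphXn, rmorphM, rmorphD, rmorphN, rmorphB) /= numqE d1 mulr1.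
by rewrite x_root eqxx.
Qed.

(* Homogeneous forms, in s = u / q, of halving_quartic and halving_cubic. *)
Definition quarticH (u q : int) : int :=
  (u ^+ 2 - t * q ^+ 2) ^+ 2
  + 4 * n ^+ 2 * q ^+ 3 * ((t + 3 * n ^+ 2) * q - 2 * n * u).

Definition cubicG (u q : int) : int :=
  n * u ^+ 3 - (t + 3 * n ^+ 2) * u ^+ 2 * q + n * t * u * q ^+ 2
  + n ^+ 4 * q ^+ 3.

(** A common prime [p] does not divide [q], so it divides the resultant and hence [D]; since [p^2]
    divides [Z^2 = H(u, q)], it would also divide [D]. *)
Lemma quarticH_cubicG_coprime u q Z : coprimez u q -> Z ^+ 2 = quarticH u q ->
  coprimez Z (q * cubicG u q).
Proof.
move=> uq EZ; rewrite coprimezE; apply/negPn/negP => Zbad.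
have [p pp] := exists_prime_dvd Zbad; rewrite dvdn_gcd => /andP[pZ pqG].
rewrite -[(p %| _)%N]/(p %| Z)%Z in pZ.
rewrite -[(p %| _)%N]/(p %| q * cubicG u q)%Z in pqG.
have pq : ~~ (p %| q)%Z.
  apply/negP => pq; have pu : (p %| u)%Z.
    rewrite -(Euclid_dvdzX pp _ 3).
    have -> : u ^+ 4 = Z * Z - q * (t ^+ 2 * q ^+ 3 - 2 * t * u ^+ 2 * q
       + 4 * n ^+ 2 * q ^+ 2 * ((t + 3 * n ^+ 2) * q - 2 * n * u)).
      by rewrite -expr2 EZ /quarticH; ring.
    by rewrite rpredB // dvdz_mulr.
  have : (p %| gcdz u q)%Z by rewrite dvdz_gcd pu.
  by rewrite (eqP uq) dvdz1; case: p pp {pZ pqG pq pu} => [|[|p]].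
have pG : (p %| cubicG u q)%Z by move: pqG; rewrite Euclid_dvdzM // (negPf pq).
(* The resultant in u of the two forms is a power of D times a power of q. *)
have pD : (p %| D)%Z.
  rewrite -(Euclid_dvdzX pp _ 1).
  have : (p %| D ^+ 2 * q ^+ 6)%Z.
    have -> : D ^+ 2 * q ^+ 6 =
      ((- 27 * n ^+ 4 - 6 * t * n ^+ 2 - 2 * t ^+ 2) * q ^+ 3
       - 5 * t * n * u * q ^+ 2 + (3 * n ^+ 2 + t) * u ^+ 2 * q + 3 * n * u ^+ 3)
         * cubicG u q
      + ((9 * n ^+ 4 + 2 * n ^+ 2 * t + t ^+ 2) * q ^+ 2
         + (6 * n ^+ 3 + 2 * n * t) * u * q - 3 * n ^+ 2 * u ^+ 2) * (Z * Z).
      by rewrite -expr2 EZ /quarticH /cubicG /D; ring.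
    by rewrite rpredD ?dvdz_mull // dvdz_mull.
  by rewrite Euclid_dvdzM // [X in _ || X]Euclid_dvdzX // (negPf pq) orbF.
have [pn p2 p3] := prime_dvd_disc pp pD.
(* Modulo p, cubicG is L^3 up to a unit; in the expansion of quarticH in powers
   of L, the terms of degree 0 and 1 are divisible by D. *)
pose m := t + 3 * n ^+ 2; pose L := 3 * n * u - m * q.
have pL : (p %| L)%Z.
  rewrite -(Euclid_dvdzX pp _ 2).
  have -> : L ^+ 3 = 27 * n ^+ 2 * cubicG u q
      - D * (q ^+ 2 * ((t + 6 * n ^+ 2) * q - 9 * n * u)).
    by rewrite /L /m /D /cubicG; ring.
  by apply: rpredB; [exact: dvdz_mull | exact: dvdz_mulr].
(* [D c q^4] is the term of degree 0 of [81 n^4 H(u, q)] in [L]. As [D - c = 12 n^2 (t - 3 n^2)] and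
   [D] is [27 n^4] modulo [t - 3 n^2], [p] does not divide [c]. *)
pose c := t ^+ 2 - 9 * n ^+ 2 * t + 45 * n ^+ 4.
have pc : ~~ (p %| c)%Z.
  apply: contra (pn) => pc.
  have pmn : (p %| t - 3 * n ^+ 2)%Z.
    have : (p %| 2 ^+ 2 * 3 * n ^+ 2 * (t - 3 * n ^+ 2))%Z.
      have -> : 2 ^+ 2 * 3 * n ^+ 2 * (t - 3 * n ^+ 2) = D - c.
        by rewrite /D /c; ring.
      by rewrite rpredB.
    by rewrite !Euclid_dvdzM // (negPf p2) (negPf p3) (negPf pn).
  have : (p %| 3 ^+ 3 * n ^+ 4)%Z.
    have -> : 3 ^+ 3 * n ^+ 4 = D - (t - 3 * n ^+ 2) * (t + 6 * n ^+ 2).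
      by rewrite /D; ring.
    by rewrite rpredB // dvdz_mulr.
  by rewrite Euclid_dvdzM // !Euclid_dvdzX // (negPf p3).
case/negP: (squarefreez_prime pp).
rewrite -(@Gauss_dvdzl _ _ (q ^+ 4 * c)); last first.
  rewrite coprimezMl andbb coprimezE /= prime_coprime //.
  rewrite -[(p %| _)%N]/(p %| q ^+ 4 * c)%Z.
  by rewrite Euclid_dvdzM // Euclid_dvdzX // negb_or pq.
have -> : D * (q ^+ 4 * c) = 81 * n ^+ 4 * (Z * Z)
    - (L ^+ 2 + 4 * L * m * q + q ^+ 2 * (6 * m ^+ 2 - 18 * t * n ^+ 2)) * (L * L)
    - 4 * (t - 3 * n ^+ 2) * q ^+ 3 * (D * L).
  by rewrite -expr2 EZ /quarticH /L /m /c /D; ring.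
by do ![apply: rpredB]; apply: dvdz_mull; exact: dvdz_mul.
Qed.

(** With [H = Y^2 + 4 N B], a square [(u - k n q)^2] bounds the cross term [n u q], hence bounds [B]
    below; then [H > 4 N^2 >= 4 n^2]. *)
Lemma quarticH_gt u q : 100 * n ^+ 2 <= t \/ t <= - (100 * n ^+ 2) -> 0 < q ->
  4 * n ^+ 2 < quarticH u q.
Proof.
move=> t_large q_gt0; pose N := n ^+ 2 * q ^+ 2; pose T := t * q ^+ 2.
pose Y := u ^+ 2 - T; pose B := T + 3 * N - 2 * (n * u * q).
have -> : quarticH u q = Y ^+ 2 + 4 * N * B.
  by rewrite /quarticH /Y /B /N /T; ring.
have n2_gt0 : 0 < n ^+ 2 by rewrite exprn_gt0.
have q2_gt0 : 0 < q ^+ 2 by rewrite exprn_gt0.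
have nN : n ^+ 2 <= N by rewrite /N ler_peMr ?(ltW n2_gt0) // -gtz0_ge1.
have N_gt0 : 0 < N := lt_le_trans n2_gt0 nN.
have NN : N <= N ^+ 2 by rewrite expr2 ler_peMr ?(ltW N_gt0) // -gtz0_ge1.
apply: (@le_lt_trans _ _ (4 * N ^+ 2)); first by lra.
case: t_large => t_large.
  have T_ge : 100 * N <= T.
    by rewrite /N /T mulrA ler_wpM2r ?(ltW q2_gt0).
  (* With [k = 10], [10 B >= 9 T - 70 N - Y], and [T >= 100 N]. *)
  have B_ge : 830 * N - Y <= 10 * B.
    have := sqr_ge0 (u - 10 * (n * q)).
    have -> : (u - 10 * (n * q)) ^+ 2 = Y + T - 20 * (n * u * q) + 100 * N.
      by rewrite /Y /N; ring.
    by rewrite /B; move: (n * u * q) => z; lra.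
  have : 0 <= 4 * N * (10 * B - (830 * N - Y)).
    by rewrite mulr_ge0 ?subr_ge0 // mulr_ge0 ?(ltW N_gt0).
  have := sqr_ge0 (3 * Y - N); have := sqr_ge0 Y.
  have : 0 < N ^+ 2 by rewrite exprn_gt0.
  by clearbody N Y B; nra.
have T_le : T <= - (100 * N).
  by rewrite /N /T mulrA -mulNr ler_wpM2r ?(ltW q2_gt0).
have Y_ge : 100 * N <= Y.
  by have := sqr_ge0 u; rewrite /Y; lra.
(* With [k = 1] the negative [T] cancels. *)
have B_ge : 2 * N - Y <= B.
  have := sqr_ge0 (u - n * q).
  have -> : (u - n * q) ^+ 2 = Y + T - 2 * (n * u * q) + N by rewrite /Y /N; ring.
  by rewrite /B; move: (n * u * q) => z; lra.
have NB : 0 <= N * (B - (2 * N - Y)) by rewrite mulr_ge0 ?subr_ge0 // ltW.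
(* This says [Y^2 - 4 N Y >= 32 N^2], so that [H >= 40 N^2]. *)
have YN : 0 <= (Y - 8 * N) * (Y + 4 * N) by apply: mulr_ge0; lra.
have N2 : 0 < N * N by rewrite mulr_gt0.
by clearbody N Y B; lra.
Qed.

Lemma no_quartic_point a u q Z :
    100 * n ^+ 2 <= t \/ t <= - (100 * n ^+ 2) -> 0 < q -> coprimez u q ->
    Z ^+ 2 = quarticH u q ->
  a * Z ^+ 2 != 4 * n ^+ 2 * (q * cubicG u q).
Proof.
move=> t_large q_gt0 uq EZ; apply/eqP => Ea.
have H_gt := quarticH_gt u t_large q_gt0; rewrite -EZ in H_gt.
have : (Z ^+ 2 %| 4 * n ^+ 2)%Z.
  rewrite -(@Gauss_dvdzl _ _ (q * cubicG u q)); first by rewrite -Ea dvdz_mull.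
  by rewrite coprimezXl // quarticH_cubicG_coprime.
move=> /dvdzP[k Ek].
have n2_gt0 : 0 < 4 * n ^+ 2 by rewrite mulr_gt0 ?exprn_gt0.
have Z2_gt0 := lt_trans n2_gt0 H_gt.
have k_gt0 : 0 < k by rewrite -(pmulr_lgt0 _ Z2_gt0) -Ek.
have : Z ^+ 2 <= k * Z ^+ 2 by rewrite ler_peMl ?(ltW Z2_gt0) // -gtz0_ge1.
by rewrite -Ek leNgt H_gt.
Qed.

End Arithmetic.

(** * Squares modulo a cubic *)

(** Lets [ring] derive a linear consequence of a known equation. *)
Lemma eq_from_sub (V : zmodType) (x y l r : V) :
  l = r -> x - y = l - r -> x = y.
Proof. by move=> ->; rewrite subrr; exact: subr0_eq. Qed.

Section CubicModulus.

Variables (F : fieldType) (a b c : F).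

Definition cubic : {poly F} := Poly [:: c; b; a; 1].

Lemma cubicE : cubic = 'X^3 + a%:P * 'X^2 + b%:P * 'X + c%:P.
Proof. by rewrite /cubic /= !cons_poly_def polyC1; ring. Qed.

Lemma rmorph_cubic (R : nzRingType) (phi : {rmorphism {poly F} -> R}) :
  phi cubic = phi 'X ^+ 3 + phi a%:P * phi 'X ^+ 2 + phi b%:P * phi 'X + phi c%:P.
Proof.
by rewrite cubicE 3!rmorphD !rmorphXn (rmorphM _ a%:P) (rmorphM _ b%:P) rmorphXn.
Qed.

Lemma size_cubic : size cubic = 4.
Proof. by rewrite /cubic (@PolyK _ 0) //= oner_neq0. Qed.

Lemma cubic_monic : cubic \is monic.
Proof. by rewrite monicE lead_coefE size_cubic coef_Poly. Qed.

Lemma horner_cubic x : cubic.[x] = x ^+ 3 + a * x ^+ 2 + b * x + c.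
Proof. by rewrite cubicE !hornerE. Qed.

(** [g] may be replaced by its remainder [al X^2 + be X + ga]; the cofactor is then [h1 X + h0] with
    [h1 = - al^2], and the other coefficients give the four equations. *)
Lemma square_mod_cubic (e w : F) (g : {poly F}) :
    cubic %| Poly [:: 0; w; e] - g ^+ 2 ->
  exists al be ga h0 : F,
    [/\ ga ^+ 2 = - (c * h0), w = 2%:R * be * ga + b * h0 - c * al ^+ 2,
        e = be ^+ 2 + 2%:R * al * ga + a * h0 - b * al ^+ 2
      & 2%:R * al * be = a * al ^+ 2 - h0].
Proof.
move=> Hg; pose r := g %% cubic.
have sz_r : (size r <= 3)%N.
  by have := ltn_modp g cubic; rewrite -size_poly_gt0 size_cubic.
have /dvdpP[h Eh] : cubic %| Poly [:: 0; w; e] - r ^+ 2.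
  have -> : Poly [:: 0; w; e] - r ^+ 2 =
     (Poly [:: 0; w; e] - g ^+ 2) + g %/ cubic * cubic * (g + r).
    have -> : g %/ cubic * cubic = g - r.
      by rewrite [in RHS](divp_eq g cubic) addrK.
    by ring.
  by rewrite dvdp_addr // -mulrA dvdp_mull // dvdp_mulr.
have sz_h : (size h <= 2)%N.
  have [->|h0] := eqVneq h 0; first by rewrite size_poly0.
  have : (size (h * cubic)%R <= 5)%N.
    rewrite -Eh (leq_trans (size_polyD _ _)) // geq_max size_polyN.
    rewrite (leq_trans (size_Poly _)) //= (leq_trans (size_polyMleq _ _)) //.
    by have := leq_add sz_r sz_r; case: (size r + size r)%N.
  by rewrite size_Mmonic ?cubic_monic // size_cubic; lia.
have Er : r = Poly [:: r`_0; r`_1; r`_2].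
  apply/polyP => -[|[|[|i]]]; rewrite coef_Poly //= nth_default ?nth_nil //.
  exact: leq_trans sz_r _.
have Eh' : h = Poly [:: h`_0; h`_1].
  apply/polyP => -[|[|i]]; rewrite coef_Poly //= nth_default ?nth_nil //.
  exact: leq_trans sz_h _.
move: Eh; rewrite Er Eh'; move: (r`_0) (r`_1) (r`_2) (h`_0) (h`_1).
move=> ga be al h0 h1 Eh {Er Eh' sz_r sz_h}.
have coefs i : (Poly [:: 0; w; e])`_i - (Poly [:: ga; be; al] ^+ 2)`_i =
    (Poly [:: h0; h1] * cubic)`_i by rewrite -coefB Eh.
have := (coefs 0%N, coefs 1%N, coefs 2%N, coefs 3%N, coefs 4%N).
rewrite !coefM !big_ord_recl !big_ord0 !coef_Poly /= => -[[[[E0 E1] E2] E3] E4].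
have Eh1 : h1 = - al ^+ 2 by apply: (eq_from_sub (esym E4)); ring.
rewrite Eh1 in E1 E2 E3; exists al, be, ga, h0; split.
- by apply: (eq_from_sub (esym E0)); ring.
- by apply: (eq_from_sub E1); ring.
- by apply: (eq_from_sub E2); ring.
by apply: (eq_from_sub (esym E3)); ring.
Qed.

End CubicModulus.

(* For A + B = (0, N^3), let s be the slope of the line through A and B; then
   x(A) - x(B) is a square root of halving_quartic s, and
   x(A - B) = 4 N^2 halving_cubic s / halving_quartic s. *)
Definition halving_quartic (F : fieldType) (N T s : F) : F :=
  (s ^+ 2 - T) ^+ 2 + 4%:R * N ^+ 2 * (T + 3%:R * N ^+ 2 - 2%:R * N * s).

Definition halving_cubic (F : fieldType) (N T s : F) : F :=
  N * s ^+ 3 - (T + 3%:R * N ^+ 2) * s ^+ 2 + N * T * s + N ^+ 4.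

Lemma square_mod_En_cubic (F : fieldType) (N T e w : F) (g : {poly F}) :
    N != 0 -> 2%:R != 0 :> F ->
    cubic T (- (N ^+ 2 * (T + 3%:R * N ^+ 2))) (N ^+ 6)
      %| Poly [:: 0; w; e] - g ^+ 2 ->
  w = 0 \/ exists s al, [/\ al != 0,
    al ^+ 2 * halving_quartic N T s = 4%:R * e
    & - w = al ^+ 2 * (N ^+ 2 * halving_cubic N T s)].
Proof.
move=> N0 two0 /square_mod_cubic[al [be [ga [h0 [E0 E1 E2 E3]]]]].
have [al0|al0] := eqVneq al 0; [left|right].
  rewrite al0 in E0 E1 E3.
  have h00 : h0 = 0 by apply: (eq_from_sub E3); ring.
  have ga0 : ga = 0 by apply/eqP; rewrite -sqrf_eq0 E0 h00 mulr0 oppr0.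
  by rewrite E1 h00 ga0; ring.
(* The constant term [N^6] is a square, so the first equation gives [- h0 = (ga / N^3)^2]; the sign
   of [s] fits the term [- 2 N s] of [halving_quartic]. *)
pose s := - (ga / (N ^+ 3 * al)).
have Ega : ga = - (s * al * N ^+ 3) by rewrite /s; field; rewrite N0 al0.
have Eh0 : h0 = - (s ^+ 2 * al ^+ 2).
  have N6 : N ^+ 6 != 0 by rewrite expf_neq0.
  apply: (mulfI N6); rewrite -[LHS]opprK -E0 Ega; ring.
have Ebe : be = al * (T + s ^+ 2) / 2%:R.
  have al2 : 2%:R * al != 0 by rewrite mulf_neq0.
  by apply: (mulfI al2); rewrite E3 Eh0; field.
exists s, al; split=> //.
  by rewrite E2 Ega Eh0 Ebe /halving_quartic; field.
by rewrite E1 Ega Eh0 Ebe /halving_cubic; field.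
Qed.

(** * Divisors of the base point *)

Section Multiples.

Variables (F : fieldType) (E : ellcurve F).
Hypothesis no2 : forall x, ~~ on_curve E (Some (x, 0)).
Implicit Types P X : option (F * F).

Lemma val_ec_mul k (P : ec_point E) :
  val (ec_mul k P) = iter k (ec_add_raw E (val P)) None.
Proof. by elim: k => //= k <-. Qed.

Lemma iter_ec_add_on_curve k P X : on_curve E P -> on_curve E X ->
  on_curve E (iter k (ec_add_raw E P) X).
Proof. by move=> HP HX; elim: k => //= k; exact: ec_add_on_curve. Qed.

Lemma iter_ec_add_opp k P :
  iter k (ec_add_raw E (ec_opp_raw P)) None =
  ec_opp_raw (iter k (ec_add_raw E P) None).
Proof. by elim: k => //= k ->; rewrite ec_oppD. Qed.

(** The first [- P] meets the last [P], so the terms cancel in pairs by [ec_addKN]. *)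
Lemma iter_ec_addK k P X : on_curve E P -> on_curve E X ->
  iter k (ec_add_raw E (ec_opp_raw P)) (iter k (ec_add_raw E P) X) = X.
Proof.
move=> HP HX; elim: k => // k IH.
by rewrite iterSr iterS ec_addKN ?iter_ec_add_on_curve.
Qed.

(* If 2kP = 0 then kP = -kP, and there is no point of order 2. *)
Lemma iter_ec_add_double k P : on_curve E P ->
  iter k.*2 (ec_add_raw E P) None = None -> iter k (ec_add_raw E P) None = None.
Proof.
move=> HP; rewrite -addnn iterD => P2k.
have := iter_ec_addK k HP (iter_ec_add_on_curve k HP (isT : on_curve E None)).
have := iter_ec_add_on_curve k HP (isT : on_curve E None).
rewrite P2k iter_ec_add_opp; case: (iter _ _ _) => [[x y]|] // Hxy [yN].
have y0 : y = 0.
  have /eqP : 2%:R * y = 0 by rewrite mulr_natl mulr2n -{1}yN addNr.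
  by rewrite mulf_eq0 (negPf (ec_two_neq0 E)) => /eqP.
by case/negP: (no2 x); rewrite -y0.
Qed.

(** Strong induction: an even [k] is halved by [iter_ec_add_double]. *)
Lemma iter_ec_add_neq0 P : on_curve E P ->
    (forall k, odd k -> iter k (ec_add_raw E P) None != None) ->
  forall k, (0 < k)%N -> iter k (ec_add_raw E P) None != None.
Proof.
move=> HP Podd k; have [m] := ubnP k; elim: m k => // m IH k lekm k_gt0.
have [/Podd//|k_even] := boolP (odd k).
have Ek : k = k./2.*2 by rewrite -[LHS]odd_double_half (negPf k_even).
have k2_gt0 : (0 < k./2)%N by lia.
apply: contra (IH k./2 _ k2_gt0); last by lia.
by rewrite {1}Ek => /eqP/(iter_ec_add_double HP) ->.
Qed.

End Multiples.

(** * Descent and integrality on the curves [En] *)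

Section MainProof.

Variables n t : int.
Hypothesis n_gt0 : 0 < n.
Hypothesis t_large : 100 * n ^+ 2 <= t \/ t <= - (100 * n ^+ 2).
Hypothesis sqf : squarefreez (t ^+ 2 + 3 * n ^+ 2 * t + 9 * n ^+ 4).

Let N0 : n%:Q != 0. Proof. by rewrite intr_eq0 gt_eqF. Qed.

Lemma quarticH_rat (s : rat) :
  (quarticH n t (numq s) (denq s))%:Q =
  (denq s)%:Q ^+ 4 * halving_quartic n%:Q t%:Q s.
Proof.
rewrite /quarticH /halving_quartic; move: (numqE s).
set d := denq s; set m := numq s => Em.
by rewrite !(rmorphXn, rmorphM, rmorphD, rmorphN, rmorphB) /= Em; ring.
Qed.

Lemma cubicG_rat (s : rat) :
  (cubicG n t (numq s) (denq s))%:Q =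
  (denq s)%:Q ^+ 3 * halving_cubic n%:Q t%:Q s.
Proof.
rewrite /cubicG /halving_cubic; move: (numqE s).
set d := denq s; set m := numq s => Em.
by rewrite !(rmorphXn, rmorphM, rmorphD, rmorphN, rmorphB) /= Em; ring.
Qed.

Lemma halving_quartic_neq0 s : halving_quartic n%:Q t%:Q s != 0.
Proof.
apply/eqP => H0; have := quarticH_gt n_gt0 (numq s) t_large (denq_gt0 s).
have -> : quarticH n t (numq s) (denq s) = 0.
  by apply: (@intr_inj rat); rewrite quarticH_rat H0 mulr0.
by rewrite ltNge mulr_ge0 // exprn_ge0 // ltW.
Qed.

Lemma no_integral_half (a : int) (s al : rat) : al != 0 ->
    al ^+ 2 * halving_quartic n%:Q t%:Q s = 4%:R ->
  a%:Q != al ^+ 2 * (n%:Q ^+ 2 * halving_cubic n%:Q t%:Q s).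
Proof.
move=> al0 Hal; apply/eqP => Ea.
(* By [al^2 H(s) = 4], [z] is a square root of [q^4 H(s) = H(u, q)], an integer; so [z] is an
   integer. *)
pose z : rat := 2%:R * (denq s)%:Q ^+ 2 / al.
have Ez : z ^+ 2 = (quarticH n t (numq s) (denq s))%:Q.
  rewrite quarticH_rat; apply: (mulfI (expf_neq0 2 al0)).
  rewrite [RHS]mulrCA Hal /z; field.
  by rewrite al0.
have z_int : z = (numq z)%:Q.
  apply: pintegral_all => p pp; apply: (pintegral_sqrt pp).
  by rewrite Ez pintegral_int.
have EZ : numq z ^+ 2 = quarticH n t (numq s) (denq s).
  by apply: (@intr_inj rat); rewrite rmorphXn /= -z_int.
have co : coprimez (numq s) (denq s) by rewrite coprimezE coprime_num_den.
have /eqP := no_quartic_point n_gt0 sqf a t_large (denq_gt0 s) co EZ; apply.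
apply: (@intr_inj rat).
rewrite [LHS]intrM rmorphXn /= -z_int Ea /z [RHS]intrM [X in _ = _ * X]intrM.
rewrite cubicG_rat rmorphM rmorphXn /=.
by field; rewrite al0.
Qed.

Local Notation E := (En t n_gt0).
Local Notation Q := (En_base t n_gt0).

Lemma En_no_two_torsion x : ~~ on_curve E (Some (x, 0)).
Proof.
apply: contra (no_rational_root n_gt0 sqf x); rewrite /= /En_a /En_b /En_c.
by rewrite expr0n /= mulNr eq_sym.
Qed.

Let f : {poly rat} := cubic (ec_a E) (ec_b E) (ec_c E).

Lemma En_cubic_irreducible : irreducible_poly f.
Proof.
apply: cubic_irreducible; first by rewrite size_cubic.
move=> x; rewrite rootE horner_cubic.
by have := En_no_two_torsion x; rewrite /on_curve expr0n eq_sym.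
Qed.

Lemma En_square (e w : rat) (g : {poly rat}) : f %| Poly [:: 0; w; e] - g ^+ 2 ->
  w = 0 \/ exists s al, [/\ al != 0,
    al ^+ 2 * halving_quartic n%:Q t%:Q s = 4%:R * e
    & - w = al ^+ 2 * (n%:Q ^+ 2 * halving_cubic n%:Q t%:Q s)].
Proof. by apply: square_mod_En_cubic. Qed.

(** Representative of [descent] in [Q[X]], where [theta] is the class of [X]. *)
Definition descent_poly (P : option (rat * rat)) : {poly rat} :=
  if P is Some (x, _) then x%:P - 'X else 1.

Lemma En_mul_square k (P : ec_point E) : exists g,
  f %| descent_poly (val (ec_mul k P)) - descent_poly (val P) ^+ odd k * g ^+ 2.
Proof.
have [L [phi [phi_surj phi_ker]]] :=
  residue_field En_cubic_irreducible (cubic_monic _ _ _).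
pose iota : {rmorphism rat -> L} := phi \o polyC.
have f0 : phi f = 0 by apply/phi_ker.
have theta_root : phi 'X ^+ 3 + iota (ec_a E) * phi 'X ^+ 2
    + iota (ec_b E) * phi 'X + iota (ec_c E) = 0.
  by rewrite -f0 rmorph_cubic.
(* Otherwise [f], of degree 3, would divide [x - X]. *)
have theta_nbase x : iota x != phi 'X.
  rewrite -subr_eq0 -[iota x]/(phi x%:P) -rmorphB; apply/eqP => /phi_ker.
  move=> /(dvdp_leq _); rewrite -opprB oppr_eq0 polyXsubC_eq0 size_polyN.
  by rewrite size_XsubC size_cubic => /(_ isT).
have phiE R : phi (descent_poly R) = descent iota (phi 'X) R.
  by case: R => [[x y]|]; rewrite /= ?rmorph1 ?rmorphB.
have [u Eu] := descent_mul theta_root theta_nbase k P.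
have [g Eg] := phi_surj u; exists g; apply/phi_ker.
by rewrite rmorphB rmorphM !rmorphXn /= !phiE Eg Eu subrr.
Qed.

(** [- X] represents the descent value of [Q]. Here [e = 0] in [En_square], which forces
    [H(s) = 0]. *)
Lemma negX_not_square (g : {poly rat}) : ~~ (f %| - 'X - g ^+ 2).
Proof.
apply/negP => Hg; have EX : Poly [:: 0; -1; 0] = - 'X :> {poly rat}.
  by rewrite /= !cons_poly_def !polyCN; ring.
rewrite -EX in Hg; have [/eqP|[s [al [al0 /eqP]]]] := En_square Hg.
  by rewrite oppr_eq0 oner_eq0.
by rewrite mulr0 mulf_eq0 expf_eq0 (negPf al0) (negPf (halving_quartic_neq0 s)).
Qed.

Lemma En_base_mul_neq0 k : (0 < k)%N ->
  iter k (ec_add_raw E (val Q)) None != None.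
Proof.
apply: iter_ec_add_neq0 => [||{}k k_odd]; first exact: En_no_two_torsion.
  exact: (valP Q).
apply/eqP; rewrite -val_ec_mul => kQ.
have [g] := En_mul_square k Q; rewrite kQ k_odd /= => Hg.
(* From [1 = - theta g^2], multiplying by [- theta] gives [- theta = (theta g)^2]. *)
have /negP := negX_not_square ('X * g); apply.
have -> : - 'X - ('X * g) ^+ 2 = - 'X * (1 - (0%:P - 'X) ^+ 1 * g ^+ 2).
  by rewrite polyC0; ring.
exact: dvdp_mull.
Qed.

Lemma En_base_divisor_odd k (P : ec_point E) : ec_mul k P = Q -> odd k.
Proof.
move=> kP; apply/negPn/negP => k_even.
have [g] := En_mul_square k P; rewrite kP (negPf k_even) /= => Hg.
have /negP := negX_not_square g; apply.
by rewrite polyC0 sub0r mul1r in Hg.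
Qed.

Lemma En_base_divisor_integral k (P : ec_point E) : ec_mul k P = Q ->
  exists (a : int) y, val P = Some (a%:Q, y).
Proof.
move=> kP; case EP: (val P) => [[x y]|]; last first.
  have : val Q = None; last by [].
  by rewrite -kP val_ec_mul EP; elim: k {kP} => //= k ->.
exists (numq x), y; rewrite -pintegral_all // => p pp.
have -> : pintegral p x = pintegral_point p (val P) by rewrite EP.
apply: (@pintegral_mul p pp E _ _ _ k); rewrite ?EP ?kP //=.
- exact: pintegral_int.
- have -> : En_b n t = (- (n ^+ 2 * (t + 3 * n ^+ 2)))%:Q.
    by rewrite /En_b !(rmorphXn, rmorphM, rmorphD, rmorphN) /=.
  exact: pintegral_int.
- by rewrite /En_c -rmorphXn pintegral_int.
exact: (pintegral_int pp 0).
Qed.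

Lemma En_base_divisor k (P : ec_point E) : ec_mul k P = Q ->
  exists y, val P = Some (0, y).
Proof.
move=> kP; have k_odd := En_base_divisor_odd kP.
have [a [y EP]] := En_base_divisor_integral kP; exists y; rewrite EP.
have [g] := En_mul_square k P; rewrite kP k_odd EP /= polyC0 sub0r expr1 => Hg.
(* Multiplying the congruence by [a - X] makes [- X (a - X) = X^2 - a X] a square modulo [f], the
   case [e = 1] of [En_square]. *)
have : f %| Poly [:: 0; - a%:Q; 1] - ((a%:Q%:P - 'X) * g) ^+ 2.
  have -> : Poly [:: 0; - a%:Q; 1] - ((a%:Q%:P - 'X) * g) ^+ 2 =
      (a%:Q%:P - 'X) * (- 'X - (a%:Q%:P - 'X) * g ^+ 2).
    by rewrite /= !cons_poly_def polyCN polyC1; ring.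
  exact: dvdp_mull.
case/En_square => [/eqP|[s [al [al0]]]]; first by rewrite oppr_eq0 => /eqP->.
rewrite mulr1 opprK => Hal /eqP Ha.
by have := no_integral_half a al0 Hal; rewrite Ha.
Qed.

Lemma En_base_not_divisible : ~ ec_divisible Q.
Proof.
case=> k [P [k2 kP]]; have [y EP] := En_base_divisor kP.
have ykn : y = n%:Q ^+ 3 \/ y = - n%:Q ^+ 3.
  have := valP P; rewrite EP /= /En_c => /eqP Ey.
  have : (y == n%:Q ^+ 3) || (y == - n%:Q ^+ 3).
    by rewrite -eqf_sqr Ey; apply/eqP; ring.
  by case/orP => /eqP; [left | right].
have := congr1 val kP; rewrite val_ec_mul EP.
have QQ := valP Q; have none : on_curve E None by [].
(* The new [k] is the predecessor of the old one. If [P = Q], cancelling gives [k Q = 0]; if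
   [P = - Q], then [(k + 2) Q = 0]. *)
case: k k2 {kP} => // k k1; case: ykn => ->.
  rewrite -[Some _]/(val Q) => kQ; have /negP := En_base_mul_neq0 k1; apply.
  have := ec_addKN En_no_two_torsion QQ (iter_ec_add_on_curve k QQ none).
  by rewrite -iterS kQ -{2}[val Q]ec_oppK ec_addN => <-.
rewrite -[Some (0, - _)]/(ec_opp_raw (val Q)) iter_ec_add_opp => kQ.
have /negP := En_base_mul_neq0 (ltn0Sn k.+1); apply.
by rewrite iterS -[iter k.+1 _ _]ec_oppK kQ ec_addN.
Qed.

End MainProof.

Theorem theorem1 (n t : int) (n_gt0 : 0 < n)
    (t_range : Num.max (100 * n ^+ 2) (n ^+ 4) <= t \/
               t <= Num.min (- (100 * n ^+ 2)) (- (2 * n ^+ 4)))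
    (sqf : squarefreez (t ^+ 2 + 3 * n ^+ 2 * t + 9 * n ^+ 4)) :
  ~ ec_divisible (En_base t n_gt0).
Proof.
apply: En_base_not_divisible sqf.
move: t_range; rewrite ge_max le_min.
by case=> [/andP[-> _]|/andP[-> _]]; [left | right].
Qed.
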